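(* Let $G$ be a finite simple graph and let $m\geq 1$ be an integer. If $G$ is triangle-free and $c(G)\geq 1$, then $c(\mathsf{M}_m(G))\geq c(G)+2$.
   Context: Graphs are finite, without loops or multiple edges. A cover graph is the underlying undirected graph of the Hasse diagram (covering relation) of a finite partially ordered set. $c(G)=\min\{|F| : F\subseteq E(G) \text{ and } G-F \text{ is a cover graph}\}$, where $G-F$ is obtained by deleting the edges in $F$ (keeping all vertices). Generalized Mycielski graph: let $G$ have vertex set $V_0=\{\langle 0,0\rangle,\langle 0,1\rangle,\ldots,\langle 0,n-1\rangle\}$ and edge set $E_0$. For an integer $m>0$, $\mathsf{M}_m(G)$ has vertex set $V_0\cup\bigcup_{i=1}^m V_i\cup\{u\}$, where $V_i=\{\langle i,j\rangle : 0\leq j\leq n-1\}$, and edge set $E_0\cup\bigcup_{i=1}^m E_i\cup\{\langle m,j\rangle u : 0\leq j\leq n-1\}$, where $E_i=\{\langle i-1,j\rangle\langle i,k\rangle : \langle 0,j\rangle\langle 0,k\rangle\in E_0\}$ for $1\leq i\leq m$ (for each edge of $E_0$ both orders of $j,k$ are used). *)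

(* Defs.v *)
From HB Require Import structures.
From mathcomp Require Import all_boot all_order.
From mathcomp Require Import boolp.

Set Implicit Arguments.
Unset Strict Implicit.
Unset Printing Implicit Defensive.

Import Order.TTheory.

Record sgraph := SGraph {
  vertex :> finType;
  adj : rel vertex;
  adj_sym : symmetric adj;
  adj_irrefl : irreflexive adj
}.

Definition edges (G : sgraph) : {set {set G}} :=
  [set [set p.1; p.2] | p : G * G & adj p.1 p.2].

Definition triangle_free (G : sgraph) : Prop :=
  forall x y z : G, ~ [/\ adj x y, adj y z & adj z x].

Section DeleteEdges.
Variables (G : sgraph) (F : {set {set G}}).

Definition del_rel : rel G := fun x y => adj x y && ([set x; y] \notin F).

Lemma del_rel_sym : symmetric del_rel.
Proof. by move=> x y; rewrite /del_rel adj_sym setUC. Qed.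

Lemma del_rel_irrefl : irreflexive del_rel.
Proof. by move=> x; rewrite /del_rel adj_irrefl. Qed.

Definition del_edges : sgraph := SGraph del_rel_sym del_rel_irrefl.
End DeleteEdges.

Definition covered_by d (P : finPOrderType d) (x y : P) : bool :=
  (x < y)%O && [forall z : P, ~~ ((x < z)%O && (z < y)%O)].

(* G is isomorphic to the undirected Hasse diagram of a finite poset. *)
Definition cover_graph (G : sgraph) : Prop :=
  exists (d : Order.disp_t) (P : finPOrderType d) (f : G -> P),
    bijective f /\
    forall x y : G,
      adj x y = covered_by (f x) (f y) || covered_by (f y) (f x).

Definition cover_deletion (G : sgraph) (F : {set {set G}}) : Prop :=
  F \subset edges G /\ cover_graph (del_edges F).

(* The minimum is over a nonempty family: F = edges G always qualifies, see
   cover_deletion_edges; cover_defect_min and cover_defect_le state that the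
   value is the minimum. *)
Definition cover_defect (G : sgraph) : nat :=
  #|[arg min_(F < edges G | `[< cover_deletion F >]) #|F|]|.

Section Antichain.
Variable T : finType.
Definition antichain : Type := T.
HB.instance Definition _ := Finite.on antichain.

Let le (x y : antichain) := x == y.
Let le_refl : reflexive le. Proof. by move=> x; apply: eqxx. Qed.
Let le_anti : antisymmetric le. Proof. by move=> x y /andP[/eqP]. Qed.
Let le_trans : transitive le. Proof. by move=> y x z /eqP ->. Qed.

HB.instance Definition _ :=
  Order.Le_isPOrder.Build (Order.Disp tt tt) antichain
    le_refl le_anti le_trans.

Lemma antichain_ltF (x y : antichain) : (x < y)%O = false.
Proof. by apply/negbTE/negP; rewrite lt_neqAle => /andP[/negP ne /ne]. Qed.
End Antichain.

Lemma cover_deletion_edges (G : sgraph) : cover_deletion (edges G).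
Proof.
split=> //; exists (Order.Disp tt tt), (antichain G), id.
split; first exact: (@Bijective G G id id (frefl _) (frefl _)).
move=> x y; rewrite /covered_by !antichain_ltF /= /del_rel.
apply/negbTE/negP => /andP[xy /negP]; apply.
by apply/imsetP; exists (x, y); rewrite ?inE.
Qed.

Lemma cover_defect_min (G : sgraph) :
  exists2 F : {set {set G}}, cover_deletion F & #|F| = cover_defect G.
Proof.
rewrite /cover_defect; case: arg_minnP => [|F /asboolP HF _].
  by apply/asboolP/cover_deletion_edges.
by exists F.
Qed.

Lemma cover_defect_le (G : sgraph) (F : {set {set G}}) :
  cover_deletion F -> cover_defect G <= #|F|.
Proof.
rewrite /cover_defect => HF; case: arg_minnP => [|F' _ min].
  by apply/asboolP/cover_deletion_edges.
by apply/min/asboolP.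
Qed.

Section Mycielski.
Variables (m : nat) (G : sgraph).

(* Some (i, x) is the copy of x in level i, None is the apex u. *)
Definition myc_rel : rel (option ('I_m.+1 * G)) := fun a b =>
  match a, b with
  | Some (i, x), Some (j, y) =>
      adj x y && [|| (i == 0 :> nat) && (j == 0 :> nat),
                     j == i.+1 :> nat | i == j.+1 :> nat]
  | Some (i, _), None | None, Some (i, _) => i == m :> nat
  | None, None => false
  end.

Lemma myc_rel_sym : symmetric myc_rel.
Proof.
move=> [[i x]|] [[j y]|] //=; rewrite adj_sym; congr (_ && _).
by rewrite andbC [(_ == j.+1) || _]orbC.
Qed.

Lemma myc_rel_irrefl : irreflexive myc_rel.
Proof. by move=> [[i x]|] //=; rewrite adj_irrefl. Qed.

Definition mycielski : sgraph := SGraph myc_rel_sym myc_rel_irrefl.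
End Mycielski.

(* Main.v *)
Require Import Defs.
From mathcomp Require Import all_boot all_order.
From HB Require Import structures.
From mathcomp Require Import ssralg ssrnum ssrint intdiv zify.

(** Orient a cover graph [M_m(G) - F] along its poset and weigh each edge [+1]
or [-1] by direction; both length-2 routes across a 4-cycle have equal weight.
Working down from the apex, this turns the weight of each edge between
consecutive levels into a difference of potentials, and at level 0 twice the
weight is such a difference, hence the parity of half the potential is a
2-colouring of [G - F_0], where [F_0] is the part of [F] in level 0.  If [F]
has a single edge outside level 0, at a copy of [j], the same holds for
[G - F_0 - j].  Moreover [|F_0| >= c(G)], since [G - F_0] is an induced subgraph
of a cover graph.  If [|F| <= c(G) + 1], put an edge of [F_0] back (two if
[F = F_0]): as [G] has no triangle, the result is 3-colourable, and a
triangle-free 3-colourable graph is a cover graph, so fewer than [c(G)] edges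
were deleted. *)

Set Implicit Arguments.
Unset Strict Implicit.
Unset Printing Implicit Defensive.

Import Order.TTheory.

(** * Cover graphs as acyclic orientations without bypasses *)

Section ConnectOrder.
Variables (T : finType) (r : rel T).

(** An alias of [T] indexed by the proof [anti], so that reachability can be its canonical order. *)
Definition connect_order (anti : antisymmetric (connect r)) : Type := T.

Variable anti : antisymmetric (connect r).

HB.instance Definition _ := Finite.on (connect_order anti).
HB.instance Definition _ :=
  Order.Le_isPOrder.Build (Order.Disp tt tt) (connect_order anti)
    (@connect0 T r) anti (@connect_trans T r).

Lemma connect_order_ltE (x y : connect_order anti) :
  (x < y)%O = (x != y) && connect r x y.
Proof. by rewrite lt_neqAle. Qed.

End ConnectOrder.

Lemma connect_step (T : finType) (r : rel T) (x y : T) :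
  connect r x y -> x != y -> exists2 z, r x z & connect r z y.
Proof.
case/connectP=> -[|z p] /=; first by move=> _ ->; rewrite eqxx.
by case/andP=> xz pz ->; exists z => //; apply/connectP; exists p.
Qed.

Lemma connect_strict_mono d (P : porderType d) (T : finType) (r : rel T)
    (f : T -> P) (x y : T) :
    (forall x y, r x y -> (f x < f y)%O) ->
  connect r x y -> x != y -> (f x < f y)%O.
Proof.
move=> mono /connectP[p]; elim: p x => [|z p IH] x /=.
  by move=> _ ->; rewrite eqxx.
case/andP=> /mono xz pz ey _; case: (eqVneq z y) => [<- //|zy].
exact: lt_trans xz (IH _ pz ey zy).
Qed.

(** The monotone [f] makes [r] acyclic, so reachability is a partial order. Its covers are arcs of
    [r], and every arc is a cover because no longer path runs parallel to it. *)
Lemma cover_graph_orientation d (P : porderType d) (G : sgraph) (r : rel G)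
    (f : G -> P) :
    (forall x y, adj x y = r x y || r y x) ->
    (forall x y, r x y -> (f x < f y)%O) ->
    (forall x y z, r x z -> connect r z y -> z != y -> ~~ r x y) ->
  cover_graph G.
Proof.
move=> adjE mono bypass.
have anti : antisymmetric (connect r).
  move=> x y /andP[xy yx]; apply/eqP; apply: contraT => nxy.
  have lt1 := connect_strict_mono mono xy nxy.
  have := connect_strict_mono mono yx; rewrite eq_sym => /(_ nxy) lt2.
  by have := lt_trans lt1 lt2; rewrite ltxx.
have irr x z : r x z -> x != z.
  by move=> /mono; apply: contraTneq => ->; rewrite ltxx.
have covE (x y : connect_order anti) : covered_by x y = r x y.
  apply/idP/idP.
    case/andP; rewrite connect_order_ltE => /andP[nxy cxy] /forallP nb.
    have [z xz zy] := connect_step cxy nxy.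
    case: (eqVneq z y) => [<- //|nzy].
    by have := nb z; rewrite !connect_order_ltE nzy zy irr // connect1.
  move=> xy; rewrite /covered_by connect_order_ltE irr // connect1 //=.
  apply/forallP => z; apply/negP; rewrite !connect_order_ltE.
  case/andP=> /andP[nxz cxz] /andP[nzy czy].
  have [t xt tz] := connect_step cxz nxz.
  have nty : t != y.
    apply: contraNneq nzy => ety; apply/eqP/anti.
    by rewrite czy -ety tz.
  by have := bypass _ _ _ xt (connect_trans tz czy) nty; rewrite xy.
exists (Order.Disp tt tt), (connect_order anti), id.
split; first exact: (@Bijective G G id id (frefl _) (frefl _)).
by move=> x y; rewrite !covE.
Qed.

(** The order taken is reachability along the inherited covers: the restricted order could have
    covers that are not edges. *)
Lemma cover_graph_induced (G H : sgraph) (i : G -> H) :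
    injective i -> (forall x y, adj (i x) (i y) = adj x y) ->
  cover_graph H -> cover_graph G.
Proof.
move=> inj_i adj_i [d [P [f [bij_f adjE]]]].
pose r : rel G := fun x y => covered_by (f (i x)) (f (i y)).
have mono x y : r x y -> (f (i x) < f (i y))%O by case/andP.
apply: (@cover_graph_orientation _ P G r (f \o i)) => //.
  by move=> x y; rewrite -adj_i adjE.
move=> x y z xz zy nzy; apply/negP => /andP[_ /forallP/(_ (f (i z)))].
by rewrite (mono _ _ xz) (connect_strict_mono mono zy nzy).
Qed.

(** * Colourings that bound the cover defect *)

(** Orient edges towards the larger colour. A path of two arcs parallel to an arc closes a triangle,
    and a path of three arcs would need four colours. *)
Lemma cover_graph_3col (G : sgraph) (col : G -> nat) :
    triangle_free G -> (forall x, col x <= 2) ->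
    (forall x y, adj x y -> col x != col y) ->
  cover_graph G.
Proof.
move=> tf col2 colP; pose r : rel G := fun x y => adj x y && (col x < col y).
have mono x y : r x y -> (col x < col y)%O by case/andP.
apply: (cover_graph_orientation (r := r) (f := col)) => //.
  move=> x y; rewrite /r [adj y x]adj_sym -andb_orr -neq_ltn.
  by case E: (adj x y); rewrite // colP.
move=> x y z xz zy nzy; have [t zt ty] := connect_step zy nzy.
case: (eqVneq t y) => [ety|nty].
  apply/negP => /andP[xy _]; case/andP: xz => xz _; case/andP: zt => zt _.
  by apply: (tf x z y); split; rewrite // -?ety // ety adj_sym.
have := connect_strict_mono mono ty nty; rewrite ltEnat /= => c3.
case/andP: xz => _ c1; case/andP: zt => _ c2; have := col2 y; lia.
Qed.

(** The independent set [T] serves as the third colour class. *)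
Lemma cover_defect_2col (G : sgraph) (F : {set {set G}}) (T : {set G})
    (col : G -> bool) :
    triangle_free G -> F \subset edges G ->
    {in T &, forall x y, ~~ adj x y} ->
    (forall x y, x \notin T -> y \notin T -> adj x y ->
       [set x; y] \notin F -> col x != col y) ->
  cover_defect G <= #|F|.
Proof.
move=> tf sF indT colP; apply: cover_defect_le; split=> //.
apply: (@cover_graph_3col (del_edges F) (fun x => if x \in T then 2 else col x)).
- by move=> x y z [/andP[xy _] /andP[yz _] /andP[zx _]]; apply: (tf x y z).
- by move=> x; case: ifP => // _; case: (col x).
move=> x y /andP[xy nF].
case: ifPn => xT; case: ifPn => yT; last 1 first.
- by have := colP _ _ xT yT xy nF; case: (col x); case: (col y).
- by have := indT _ _ xT yT; rewrite xy.
- by case: (col y).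
- by case: (col x).
Qed.

Lemma edges_set2 (G : sgraph) (x y : G) : ([set x; y] \in edges G) = adj x y.
Proof.
apply/imsetP/idP => [[[a b] /= ]|xy]; last by exists (x, y); rewrite ?inE.
rewrite inE /= => ab E.
have xab : x \in [set a; b] by rewrite -E set21.
have yab : y \in [set a; b] by rewrite -E set22.
have axy : a \in [set x; y] by rewrite E set21.
have bxy : b \in [set x; y] by rewrite E set22.
move: xab yab axy bxy ab; rewrite !inE.
case/orP=> /eqP ->; case/orP=> /eqP -> //.
- by rewrite !orbb => _ /eqP ->; rewrite adj_irrefl.
- by rewrite adj_sym.
- by rewrite !orbb => /eqP -> _; rewrite adj_irrefl.
Qed.

Lemma edgesP (G : sgraph) (e : {set G}) :
  e \in edges G -> exists x y, adj x y /\ e = [set x; y].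
Proof.
by case/imsetP => -[x y]; rewrite inE /= => xy ->; exists x, y.
Qed.

(** The third colour is spent on [j] and on an end of one edge of [F], which can then be put
    back. *)
Lemma cover_defect_2col_but1 (G : sgraph) (F : {set {set G}}) (j : G)
    (col : G -> bool) :
    triangle_free G -> F \subset edges G ->
    (forall x y, x != j -> y != j -> adj x y ->
       [set x; y] \notin F -> col x != col y) ->
  cover_defect G <= #|F|.-1.
Proof.
move=> tf sF colP; case: (set_0Vmem F) => [F0|[e eF]].
  rewrite F0 cards0 -[0.-1](cards0 {set G}).
  apply: (cover_defect_2col (T := [set j]) (col := col) tf); first exact: sub0set.
    by move=> x y /set1P-> /set1P->; rewrite adj_irrefl.
  by move=> x y; rewrite !inE => xj yj xy _; apply: colP; rewrite ?F0 ?inE.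
have [a [b [ab E]]] := edgesP (subsetP sF e eF).
(* If [j] were adjacent to both ends of [e], there would be a triangle. *)
have [c ce njc] : exists2 c, c \in e & ~~ adj j c.
  case: (boolP (adj j a)) => ja; last by exists a; rewrite // E set21.
  exists b; first by rewrite E set22.
  by apply/negP => jb; apply: (tf j a b); split; rewrite // adj_sym.
rewrite (cardsD1 e) eF /=.
apply: (cover_defect_2col (T := [set j; c]) (col := col) tf).
- exact: subset_trans (subD1set _ _) sF.
- move=> x y /set2P[]-> /set2P[]->; rewrite ?adj_irrefl //.
  by rewrite adj_sym.
move=> x y; rewrite !inE !negb_or => /andP[xj xc] /andP[yj yc] xy.
rewrite negb_and negbK; case/orP=> [/eqP xye|]; last exact: colP.
by move: ce; rewrite -xye !inE [c == x]eq_sym [c == y]eq_sym (negPf xc) (negPf yc).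
Qed.

(** * Edge weights and potentials *)

Section Potential.
Import GRing.Theory.
Local Open Scope ring_scope.

Definition square_weight (H : sgraph) (w : H -> H -> int) :=
  forall a b c d, adj a b -> adj b c -> adj a d -> adj d c ->
    w a b + w b c = w a d + w d c.

(** Routes of unequal weight would give a directed 4-cycle, or a chain of three steps parallel to a
    cover. *)
Lemma cover_weight (H : sgraph) : cover_graph H ->
  exists w : H -> H -> int,
    [/\ forall a b, adj a b -> w a b = 1 \/ w a b = -1,
        forall a b, adj a b -> w a b = - w b a & square_weight w].
Proof.
case=> d [P [f [_ adjE]]].
pose w (a b : H) : int := if (f a < f b)%O then 1 else -1.
exists w; split.
- by move=> a b _; rewrite /w; case: ifP => _; [left|right].
- move=> a b; rewrite adjE /w => /orP[] /andP[lt _].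
    by rewrite lt (lt_gtF lt).
  by rewrite lt (lt_gtF lt).
have adj_cov a b : adj a b ->
    (covered_by (f a) (f b) /\ w a b = 1) \/
    (covered_by (f b) (f a) /\ w a b = -1).
  rewrite adjE => /orP[] cov; [left | right]; split=> //; rewrite /w.
    by case/andP: cov => ->.
  by case/andP: cov => lt _; rewrite (lt_gtF lt).
have no_chain x y z : (f x < f y)%O -> (f y < f z)%O ->
    covered_by (f x) (f z) -> False.
  by move=> xy yz /andP[_ /forallP/(_ (f y))]; rewrite xy yz.
have lt_cov x y : covered_by (f x) (f y) -> (f x < f y)%O by case/andP.
move=> a b c e /adj_cov ab /adj_cov bc /adj_cov ae /adj_cov ec.
case: ab => -[ab ->]; case: bc => -[bc ->]; case: ae => -[ae ->];
  case: ec => -[ec ->] //; exfalso;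
  move: (lt_cov _ _ ab) (lt_cov _ _ bc) (lt_cov _ _ ae) (lt_cov _ _ ec)
   => lab lbc lae lec.
all: try by [ apply: no_chain (lt_trans lab lbc) lec ae
  | apply: no_chain lae (lt_trans lab lbc) ec
  | apply: no_chain (lt_trans lbc lab) lae ec
  | apply: no_chain lec (lt_trans lbc lab) ae
  | apply: no_chain (lt_trans lae lec) lbc ab
  | apply: no_chain lab (lt_trans lae lec) bc
  | apply: no_chain (lt_trans lec lae) lab bc
  | apply: no_chain lbc (lt_trans lec lae) ab
  | have := lt_trans (lt_trans lab lbc) (lt_trans lec lae); rewrite ltxx
  | have := lt_trans (lt_trans lbc lab) (lt_trans lae lec); rewrite ltxx ].
Qed.

(** Two [e]-predecessors [x], [z] of [y] span the 4-cycle [a y], [b x], [c y], [b z]; there [q y]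
    cancels, so [p x - w (a y) (b x)] depends on [y] alone. *)
Lemma potential_step (T : finType) (H : sgraph) (w : H -> H -> int) (e : rel T)
    (a b c : T -> H) (p q : T -> int) :
    square_weight w ->
    (forall x y, e x y -> adj (a y) (b x)) ->
    (forall x y, e x y -> adj (b x) (c y)) ->
    (forall x y, e x y -> w (b x) (c y) = q y - p x) ->
  exists r : T -> int, forall x y, e x y -> w (a y) (b x) = p x - r y.
Proof.
move=> sq ab bc wE.
exists (fun y => if [pick x | e x y] is Some x then p x - w (a y) (b x) else 0).
move=> x y xy; case: pickP => [z zy|/(_ x)]; last by rewrite xy.
have := sq _ _ _ _ (ab _ _ xy) (bc _ _ xy) (ab _ _ zy) (bc _ _ zy).
rewrite !wE //; lia.
Qed.

Lemma levels_2col (T : finType) (H : sgraph) (e : rel T) (k : nat)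
    (lev : nat -> T -> H) (u : H) :
    cover_graph H -> symmetric e -> (0 < k)%N -> (forall x, lev k x = u) ->
    (forall x y, e x y -> adj (lev 0%N x) (lev 0%N y)) ->
    (forall i x y, (i < k)%N -> e x y -> adj (lev i x) (lev i.+1 y)) ->
  exists col : T -> bool, forall x y, e x y -> col x != col y.
Proof.
move=> /cover_weight[w [w1 wN sq]] esym k0 levk lev0 levS.
have down i : (i < k)%N -> exists p q : T -> int,
    forall x y, e x y -> w (lev (k - i.+1)%N x) (lev (k - i)%N y) = q y - p x.
  elim: i => [_|i IH ik].
    (* All upper ends are the apex [u], so the weight depends on the lower end only. *)
    exists (fun x => - w (lev (k - 1)%N x) u), (fun=> 0) => x y _.
    by rewrite subn0 levk sub0r opprK.
  have [p [q pq]] := IH (ltnW ik).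
  have [||r rP] := @potential_step T H w e (lev (k - i.+2)%N) (lev (k - i.+1)%N)
      (lev (k - i)%N) p q sq _ _ pq.
  - move=> x y xy; rewrite (_ : k - i.+1 = (k - i.+2).+1)%N; last by lia.
    by apply: levS; [lia | rewrite esym].
  - move=> x y xy; rewrite (_ : k - i = (k - i.+1).+1)%N; last by lia.
    by apply: levS => //; lia.
  by exists r, p => x y xy; apply: rP; rewrite esym.
(* This index gives the edges between levels 0 and 1; one more step, with [lev 0] as both [a] and
   [b], reaches the edges inside level 0. *)
have [|p [q]] := down k.-1; first by lia.
rewrite prednK // subnn (_ : k - k.-1 = 1)%N => [pq|]; last by lia.
have [||r rP] := @potential_step T H w e (lev 0%N) (lev 0%N) (lev 1%N) p q sq _ _ pq.
- by move=> x y xy; apply: lev0; rewrite esym.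
- by move=> x y xy; apply: levS.
(* Adding [rP] at [(x, y)] and [(y, x)] gives [2 w = (p + r) y - (p + r) x], so
   [p + r] changes by exactly 2 along each edge. *)
exists (fun x => ((p x + r x) %% 4)%Z < 2) => x y xy.
have yx : e y x by rewrite esym.
have := rP _ _ xy; have := rP _ _ yx; have := wN _ _ (lev0 _ _ xy).
case: (w1 _ _ (lev0 _ _ xy)) => ->; lia.
Qed.

End Potential.

(** * Splitting the deleted edges by level *)

Section MycielskiLevels.
Variables (G : sgraph) (m : nat) (F : {set {set mycielski m G}}).

Definition base (x : G) : mycielski m G := Some (ord0, x).

Definition base_part : {set {set G}} := [set e in edges G | base @: e \in F].

Lemma base_inj : injective base.
Proof. by move=> x y []. Qed.

Lemma base_set2 (x y : G) : base @: [set x; y] = [set base x; base y].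
Proof. by rewrite imsetU1 imset_set1. Qed.

Lemma base_part_sub : base_part \subset edges G.
Proof. by apply/subsetP => e; rewrite inE => /andP[]. Qed.

Lemma adj_base (x y : G) :
  adj (base x : del_edges F) (base y) = adj (x : del_edges base_part) y.
Proof.
rewrite /= /del_rel /= andbT inE edges_set2 base_set2.
by case: (adj x y).
Qed.

Lemma cover_defect_base :
  cover_graph (del_edges F) -> cover_defect G <= #|base_part|.
Proof.
move=> cov; apply: cover_defect_le; split; first exact: base_part_sub.
by apply: cover_graph_induced cov; [exact: base_inj | exact: adj_base].
Qed.

Definition upper_part := F :\: [set base @: e | e : {set G} in base_part].

Lemma card_base_upper : #|F| = #|base_part| + #|upper_part|.
Proof.
rewrite -(card_imset (mem base_part) (imset_inj base_inj)).
set A := [set _ | _ in _]; rewrite -(cardsID A F) (setIidPr _) //.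
by apply/subsetP => _ /imsetP[e + ->]; rewrite inE => /andP[].
Qed.

Lemma upper_partP (e : {set mycielski m G}) (p : mycielski m G) :
  e \in F -> p \in e -> (forall x, p != base x) -> e \in upper_part.
Proof.
move=> eF pe np; rewrite inE eF andbT; apply/imsetP => -[a _ E].
by move: pe; rewrite E => /imsetP[x _ px]; move: (np x); rewrite px eqxx.
Qed.

(** Past level [m] every copy collapses to the apex, which thus acts as level [m.+1]. *)
Definition level (i : nat) (x : G) : mycielski m G :=
  if i <= m then Some (inord i, x) else None.

Lemma adj_levelS i x y : i <= m -> adj x y -> adj (level i x) (level i.+1 y).
Proof.
move=> im xy; rewrite /level im; case: ifPn => [im1|].
  by rewrite /= xy !inordK // eqxx orbT.
by rewrite -leqNgt /= inordK // eqn_leq im.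
Qed.

(** Each deleted edge outside level 0 touches a copy of a vertex outside [S], so all edges between
    levels that lie over edges within [S] survive. *)
Lemma base_2col (S : pred G) :
    cover_graph (del_edges F) ->
    (forall e, e \in upper_part -> exists i x, Some (i, x) \in e /\ ~~ S x) ->
  exists col : G -> bool, forall x y, S x -> S y -> adj x y ->
    [set x; y] \notin base_part -> col x != col y.
Proof.
move=> cov upS.
pose e : rel G := fun x y => [&& S x, S y & adj (x : del_edges base_part) y].
have [||||| col colP] := @levels_2col G (del_edges F) e m.+1 level None cov.
- by move=> x y; rewrite /e adj_sym andbCA.
- by [].
- by move=> x; rewrite /level ltnn.
- move=> x y /and3P[_ _]; rewrite -adj_base /level leq0n.
  by rewrite (_ : inord 0 = ord0) //; apply/val_inj; rewrite /= inordK.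
- move=> i x y im /and3P[Sx Sy /andP[xy _]]; apply/andP; split.
    exact: adj_levelS.
  apply/negP => eF.
  have /(upper_partP eF (set22 _ _))/upS[j [z []]] z0 : level i.+1 y != base z0.
    rewrite /level; case: ifPn => // im1; apply/eqP => -[/(congr1 val)] /=.
    by rewrite inordK.
  rewrite !inE /level -ltnS im; case: ifP => _ /orP[] // /eqP[_ ->];
    by rewrite ?Sx ?Sy.
exists col => x y Sx Sy xy nF; apply: colP.
by rewrite /e Sx Sy /= /del_rel xy.
Qed.

End MycielskiLevels.

(** * Counting the deleted edges in level 0 and above *)

Theorem corollary13 (G : sgraph) (m : nat) (hm : 1 <= m)
    (htf : triangle_free G) (hc : 1 <= cover_defect G) :
  cover_defect G + 2 <= cover_defect (mycielski m G).
Proof.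
have [F [sF cov] <-] := cover_defect_min (mycielski m G).
have le0 := cover_defect_base cov; have cF := card_base_upper F.
rewrite leqNgt; apply/negP => ltF.
case: (set_0Vmem (upper_part F)) => [U0|[e eU]].
  have [|col colP] := @base_2col G m F xpredT cov.
    by move=> e; rewrite U0 inE.
  have /card_gt0P[e eF] : 0 < #|base_part F| by apply: leq_trans le0.
  have [a [b [ab E]]] := edgesP (subsetP (base_part_sub F) e eF).
  have sF1 := subset_trans (subD1set _ e) (base_part_sub F).
  (* The excepted vertex [a] is an end of [e], so [e] goes back along with one further edge, if any
     is left. *)
  have := @cover_defect_2col_but1 G (base_part F :\ e) a col htf sF1.
  suff colP1 x y : x != a -> y != a -> adj x y ->
      [set x; y] \notin base_part F :\ e -> col x != col y.
    move=> /(_ colP1); move: cF; rewrite (cardsD1 e (base_part F)) eF U0 cards0.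
    lia.
  move=> xa ya xy; rewrite in_setD1 negb_and negbK.
  case/orP=> [/eqP xye|]; last exact: colP.
  have := set21 a b.
  by rewrite -E -xye !inE ![a == _]eq_sym (negPf xa) (negPf ya).
(* At least [cover_defect G] of at most [cover_defect G + 1] deleted edges lie in level 0, leaving
   room for only one above. *)
have /eqP U1 : upper_part F == [set e].
  by rewrite eq_sym eqEcard sub1set eU cards1; lia.
have eE : e \in edges (mycielski m G) by move: eU; rewrite inE => /andP[_ /(subsetP sF)].
(* The apex has no loop, so [e] has an end that is a copy of some [j]. *)
have [i [j je]] : exists i j, Some (i, j) \in e.
  have [[[i x]|] [[[k y]|] [//= _ ->]]] := edgesP eE.
  - by exists i, x; rewrite set21.
  - by exists i, x; rewrite set21.
  - by exists k, y; rewrite set22.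
have [|col colP] := @base_2col G m F (fun x => x != j) cov.
  by move=> f; rewrite U1 => /set1P ->; exists i, j; rewrite eqxx.
have := cover_defect_2col_but1 htf (base_part_sub F) colP.
have : 0 < #|upper_part F| by rewrite U1 cards1.
lia.
Qed.
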